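(* Let $\nu$ be the zero-mean $k$-variate complex Gaussian distribution on $\mathbb C^k$ with covariance matrix $\Sigma$. Let $\mathcal D\subset\Omega_m^k$ be a set of $n\ge1$ nodes and let $f=\sum_{\alpha\in\mathbb Z_m^k}b_\alpha z^\alpha$ be the polynomial representation of its indicator function over $\Omega_m^k$. Let $S\subset S_m$ be a set of monomials such that the pair $(\mathcal D,\operatorname{Span}_{\mathbb C}(S))$ is correct, and let $$w_S=\left(X_{\mathcal D,S}^t\right)^{-1}\left[\int_{\mathbb C^k}s\,d\nu\right]_{s\in S},\qquad X_{\mathcal D,S}=[s(d)]_{d\in\mathcal D,\,s\in S}.$$ If $w_S=\frac1n1_n$, then $$\{1\}\cup\left\{z^\alpha\ :\ \alpha\in\mathbb Z_{\ge0}^k,\ z^{[\alpha]_m}\notin\operatorname{Supp}(f)\right\}$$ is the precision basis for $(\mathcal D,w_S)$ (with respect to $\nu$).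
   Context: The zero-mean $k$-variate complex Gaussian distribution with (Hermitian positive definite) covariance matrix $\Sigma=E(Z\overline Z^t)$ is the probability measure on $\mathbb C^k$ with density $\frac{1}{\pi^k\det(\Sigma)}\exp(-\overline z^t\Sigma^{-1}z)$ with respect to Lebesgue measure on $\mathbb C^k\cong\mathbb R^{2k}$. Here $m\ge1$ is an integer and $\Omega_m\subset\mathbb C$ is the set of $m$-th roots of unity. For $\alpha\in\mathbb Z_{\ge0}^k$, $z^\alpha=z_1^{\alpha_1}\cdots z_k^{\alpha_k}$, and $[\alpha]_m\in\{0,\dots,m-1\}^k$ is the vector of residues of the $\alpha_i$ modulo $m$. $\mathbb Z_m$ is identified with $\{0,\dots,m-1\}$, and $S_m=\{z^\alpha:\alpha\in\mathbb Z_m^k\}$. For $\alpha\in\mathbb Z_m^k$, $\overline\alpha\in\mathbb Z_m^k$ denotes the vector of residues of $m-\alpha_i$ modulo $m$. The indicator function of $\mathcal D$ over $\Omega_m^k$ (equal to $1$ on $\mathcal D$ and $0$ on $\Omega_m^k\setminus\mathcal D$) is represented by the unique interpolating polynomial $f=\sum_{\alpha\in\mathbb Z_m^k}b_\alpha z^\alpha\in\operatorname{Span}_{\mathbb C}(S_m)$, with $b_\alpha=\frac1{m^k}\sum_{d\in\mathcal D}z^{\overline\alpha}(d)$. $\operatorname{Supp}(f)=\{z^\alpha:\alpha\in\mathbb Z_m^k,\ b_\alpha\ne0\}$. The pair $(\mathcal D,\mathcal P)$, with $\mathcal P$ a set of polynomials, is correct if for every $g:\mathbb C^k\to\mathbb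 C$ there is a unique $p\in\mathcal P$ with $p(d)=g(d)$ for all $d\in\mathcal D$; for $\mathcal P=\operatorname{Span}_{\mathbb C}(S)$ this is equivalent to $X_{\mathcal D,S}$ being square and non-singular. $1_n$ is the all-ones vector of length $n$. The precision basis of $(\mathcal D,w)$, $w=[w_d]_{d\in\mathcal D}$, is the set $\mathcal B$ of monomials $z^\alpha$, $\alpha\in\mathbb Z_{\ge0}^k$, such that $\int_{\mathbb C^k}z^\alpha\,d\nu=\sum_{d\in\mathcal D}w_d\,z^\alpha(d)$ for all $z^\alpha\in\mathcal B$ and $\int_{\mathbb C^k}z^\alpha\,d\nu\ne\sum_{d\in\mathcal D}w_d\,z^\alpha(d)$ for all monomials $z^\alpha\notin\mathcal B$. *)

(* Defs.v *)
From HB Require Import structures.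
From mathcomp Require Import all_boot all_order all_algebra.
From mathcomp Require Import all_classical all_reals all_analysis.
From mathcomp Require Import complex.
(* The notations of mpoly clash with those of MathComp-Analysis, so only its
   constants are imported: [mpoly k C] is C[z_1, ..., z_k], [multinom k] is the
   type of exponent vectors and [mpolyX C a] is the monomial z^a. *)
From mathcomp Require Import -(notations) mpoly.

Set Implicit Arguments.
Unset Strict Implicit.
Unset Printing Implicit Defensive.

Import Order.TTheory GRing.Theory Num.Theory.
Import numFieldNormedType.Exports.

Local Open Scope classical_set_scope.
Local Open Scope ring_scope.
Local Open Scope complex_scope.
Local Open Scope sesquilinear_scope.

(* C^k is identified with (R^2)^k, with its product (i.e. Borel) sigma-algebra;
   [cvect] is the identification (x_j, y_j)_j |-> (x_j + i y_j)_j. *)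
Notation Cspace R k := (k.-tuple (measurableTypeR R * measurableTypeR R)%type).

Definition cvect (R : realType) (k : nat) (x : Cspace R k) : 'cV[R[i]]_k :=
  \col_j ((tnth x j).1 +i* (tnth x j).2).

Definition ccons (R : realType) (k : nat)
    (p : measurableTypeR R * (measurableTypeR R * Cspace R k)) :
    Cspace R k.+1 :=
  [tuple of (p.1, p.2.1) :: p.2.2].

Lemma measurable_ccons (R : realType) (k : nat) :
  measurable_fun
    [set: measurableTypeR R * (measurableTypeR R * Cspace R k)] (@ccons R k).
Proof.
apply: (measurable_cons (f := fun p => (p.1, p.2.1)) (g := fun p => p.2.2)).
  apply: measurable_fun_pair; first exact: measurable_fst.
  exact: measurableT_comp measurable_fst measurable_snd.
exact: measurableT_comp measurable_snd measurable_snd.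
Qed.

(* Lebesgue measure on C^k, as an iterated product of the one-dimensional
   Lebesgue measure; the constant of the library used in the second case is the
   pushforward by [ccons], bundled as a measure. *)
Fixpoint lebesgueC (R : realType) (k : nat) :
    {measure set (Cspace R k) -> \bar R} :=
  match k with
  | 0 => dirac ([tuple] : Cspace R 0)
  | k'.+1 => measure_function_pushforward__canonical__measure_function_Measure
      (lebesgue_measure \x^ (lebesgue_measure \x^ lebesgueC R k'))%E
      (@measurable_ccons R k')
  end.

Lemma lebesgueC_box (R : realType) (k : nat)
    (A B : 'I_k -> set (measurableTypeR R)) :
  (forall i, measurable (A i)) -> (forall i, measurable (B i)) ->
  (lebesgueC R k [set x | forall i, A i (tnth x i).1 /\ B i (tnth x i).2] =
  \prod_(i < k) (lebesgue_measure (A i) * lebesgue_measure (B i)))%E.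
Proof.
elim: k A B => [|k IH] A B mA mB.
  by rewrite big_ord0 /= diracE mem_set // => -[].
pose A' i := A (lift ord0 i); pose B' i := B (lift ord0 i).
pose X := [set x : Cspace R k | forall i, A' i (tnth x i).1 /\ B' i (tnth x i).2].
have mX : measurable X.
  rewrite (_ : X = \bigcap_(i in [set: 'I_k])
      ((@tnth _ _ ^~ i) @^-1` (A' i `*` B' i))).
    apply: fin_bigcap_measurable => // i _.
    rewrite -[X in measurable X]setTI.
    by apply: measurable_tnth => //; apply: measurableX; rewrite /A' /B'.
  by apply/seteqP; split => x /= H i; [move=> _|]; have := H i => // /(_ I).
rewrite big_ord_recl /= /pushforward.
rewrite (_ : _ @^-1` _ = A ord0 `*` (B ord0 `*` X)).
  rewrite product_measure2E //; last exact: measurableX.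
  have <- := IH A' B' (fun i => mA _) (fun i => mB _).
  by rewrite /= product_measure2E // muleA.
apply/seteqP; split => -[x [y t]] /=.
  move=> H; have /= [] := H ord0; rewrite ?tnth0 /= => ? ?.
  by split => //; split => // i; have := H (lift ord0 i); rewrite !tnthS.
move=> [Ax [By H]] i; case: (unliftP ord0 i) => [j|] ->; last by [].
by rewrite !tnthS; exact: H.
Qed.

(* The quadratic form and the determinant below are real when Sigma is Hermitian
   positive definite, so taking real parts loses nothing. *)
Definition cgauss_density (R : realType) (k : nat) (Sigma : 'M[R[i]]_k)
    (z : 'cV[R[i]]_k) : R :=
  (pi ^+ k * complex.Re (\det Sigma))^-1
    * expR (- complex.Re ((z ^t* *m invmx Sigma *m z) ord0 ord0)).

(* On R[i], 0 < c means that c is real and positive. *)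
Definition hermitian_posdef (R : realType) (k : nat) (Sigma : 'M[R[i]]_k) :=
  Sigma ^t* = Sigma /\
  forall z : 'cV[R[i]]_k, z != 0 -> 0 < (z ^t* *m Sigma *m z) ord0 ord0.

(* [nu] is the zero-mean complex Gaussian distribution with covariance Sigma:
   the probability measure with density [cgauss_density Sigma]. *)
Definition complex_gaussian (R : realType) (k : nat) (Sigma : 'M[R[i]]_k)
    (nu : probability (Cspace R k) R) :=
  forall A : set (Cspace R k), measurable A ->
    (nu A = \int[lebesgueC R k]_(x in A) (cgauss_density Sigma (cvect x))%:E)%E.

Definition cintegral (R : realType) d (T : measurableType d)
    (mu : {measure set T -> \bar R}) (h : T -> R[i]) : R[i] :=
  (\int[mu]_x complex.Re (h x)) +i* (\int[mu]_x complex.Im (h x)).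

Definition peval (R : realType) (k : nat) (z : 'cV[R[i]]_k)
    (p : mpoly k R[i]) : R[i] := meval (fun j => z j ord0) p.

Definition monom_at (R : realType) (k : nat) (a : multinom k)
    (z : 'cV[R[i]]_k) : R[i] := peval z (mpolyX R[i] a).

Definition moment (R : realType) (k : nat) (nu : probability (Cspace R k) R)
    (a : multinom k) : R[i] := cintegral nu (fun x => monom_at a (cvect x)).

(* Sets of monomials are represented by sets of exponent vectors. *)
Definition monomials_lt (k m : nat) : set (multinom k) :=
  [set a | forall j, (a j < m)%N].

Definition mresidue (k m : nat) (a : multinom k) : multinom k :=
  Multinom [tuple (a j %% m)%N | j < k].

Definition mspan (R : realType) (k : nat) (M : set (multinom k)) :
    set (mpoly k R[i]) :=
  [set p | exists (s : seq (multinom k)) (c : multinom k -> R[i]),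
     (forall a, a \in s -> M a) /\ p = \sum_(a <- s) c a *: mpolyX R[i] a].

Definition root_grid (R : realType) (k m : nat) : set 'cV[R[i]]_k :=
  [set z | forall j, z j ord0 ^+ m = 1].

Definition interpolates_indicator (R : realType) (k m : nat)
    (D : seq 'cV[R[i]]_k) (f : mpoly k R[i]) :=
  mspan (monomials_lt m) f /\
  forall z, root_grid m z -> peval z f = (z \in D)%:R.

Definition correct_pair (R : realType) (k : nat) (D : seq 'cV[R[i]]_k)
    (P : set (mpoly k R[i])) :=
  forall g : 'cV[R[i]]_k -> R[i],
    exists! p, P p /\ forall d, d \in D -> peval d p = g d.

(* Finite sets of nodes and of monomials are listed, without repetition, by
   tuples; matrices and weights are indexed by the positions in these lists. *)
Definition design_mx (R : realType) (k n q : nat) (D : n.-tuple 'cV[R[i]]_k)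
    (S : q.-tuple (multinom k)) : 'M[R[i]]_(n, q) :=
  \matrix_(i, j) monom_at (tnth S j) (tnth D i).

(* The inverse of a matrix whose two dimensions are equal but not convertible
   ([conform_mx 0] is then a mere cast); 0 when the dimensions differ. *)
Definition invmx_dim (F : fieldType) (q n : nat) (A : 'M[F]_(q, n)) :
    'M[F]_(n, q) :=
  conform_mx 0 (invmx (conform_mx (0 : 'M[F]_n) A)).

Lemma invmx_dimE (F : fieldType) (n : nat) (A : 'M[F]_n) :
  invmx_dim A = invmx A.
Proof. by rewrite /invmx_dim !conform_mx_id. Qed.

Definition weights (R : realType) (k n q : nat)
    (nu : probability (Cspace R k) R) (D : n.-tuple 'cV[R[i]]_k)
    (S : q.-tuple (multinom k)) : 'cV[R[i]]_n :=
  invmx_dim (design_mx D S)^T *m (\col_j moment nu (tnth S j)).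

Definition precision_basis (R : realType) (k n : nat)
    (nu : probability (Cspace R k) R) (D : n.-tuple 'cV[R[i]]_k)
    (w : 'cV[R[i]]_n) (B : set (multinom k)) :=
  let exact_on a :=
    moment nu a = \sum_(i < n) w i ord0 * monom_at a (tnth D i) in
  (forall a, B a -> exact_on a) /\ (forall a, ~ B a -> ~ exact_on a).

(* Main.v *)
Require Import Defs.
From HB Require Import structures.
From mathcomp Require Import all_boot all_order all_algebra.
From mathcomp Require Import all_classical all_reals all_analysis.
From mathcomp Require Import measurable_realfun.
From mathcomp Require Import cyclic separable cyclotomic ring.
From mathcomp Require Import complex.
From mathcomp Require Import -(notations) mpoly.

(** Both sides of the quadrature identity can be computed in closed form.

    On the side of the integral, the density of [nu] depends on z only through
    a Hermitian form, so that it is unchanged by z |-> c z when |c| = 1, and so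
    is the Lebesgue measure of C^k.  Hence [nu] is invariant under these
    rotations ([complex_gaussian_rotate]).  A monomial z^a of degree N > 0 is
    multiplied by c^N; with c an N-th root of -1 it changes sign, so its
    integral vanishes ([complex_gaussian_moment_eq0]), while the integral of
    the constant 1 is 1.

    The invariance of the Lebesgue measure comes from the classical
    factorization of a plane rotation into three shears
    (x, y) |-> (x + t y, y), (x, y) |-> (x, y + b x), (x, y) |-> (x + t y, y).
    A shear moves each line parallel to an axis by a translation, so that
    computing a measure through its sections along that axis shows that it is
    preserved.

    On the side of the nodes, the weights being all equal to 1/n, exactness on
    z^a with a <> 0 means that the sum of z^a over D is zero.  This sum depends
    on a modulo m only, because the nodes have m-th roots of unity as
    coordinates, and orthogonality of the monomials over the grid identifies
    its conjugate with m^k times the coefficient of z^[a] in the indicator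
    function ([indicator_coefficient]).  So it is zero exactly when z^[a] is
    not in the support of f ([msupp_indicator]). *)

Set Implicit Arguments.
Unset Strict Implicit.
Unset Printing Implicit Defensive.

Import Order.TTheory GRing.Theory Num.Theory.
Import numFieldNormedType.Exports.

Local Open Scope classical_set_scope.
Local Open Scope ring_scope.
Local Open Scope complex_scope.
Local Open Scope sesquilinear_scope.

(** * Measure-preserving maps of products *)

Definition preserves d (T : measurableType d) (R : realType)
    (mu : set T -> \bar R) (g : T -> T) :=
  measurable_fun setT g /\ forall A, measurable A -> mu (g @^-1` A) = mu A.

Lemma measurable_preimage d d' (T : measurableType d) (T' : measurableType d')
    (g : T -> T') (A : set T') :
  measurable_fun setT g -> measurable A -> measurable (g @^-1` A).
Proof. by move=> mg mA; rewrite -[X in measurable X]setTI; exact: mg. Qed.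

Lemma preserves_comp d (T : measurableType d) (R : realType)
    (mu : set T -> \bar R) (g h : T -> T) :
  preserves mu g -> preserves mu h -> preserves mu (g \o h).
Proof.
move=> [mg Hg] [mh Hh]; split; first exact: measurableT_comp.
move=> A mA; rewrite comp_preimage Hh ?Hg //; exact: measurable_preimage.
Qed.

(** Measures defined by recursion, such as [lebesgueC], come without a bundled
    proof of sigma-finiteness; this turns the property into the structure on
    which the theory of product measures is based. *)
Lemma bundle_sigma_finite d (T : measurableType d) (R : realType)
    (mu : {measure set T -> \bar R}) :
  sigma_finite setT mu ->
  exists M : {sigma_finite_measure set T -> \bar R},
    M = mu :> (set T -> \bar R).
Proof.
move=> smu.
pose sf := isSFinite.Build _ _ _ _ (sfinite_measure_sigma_finite smu).
pose sgf := isSigmaFinite.Build _ _ _ _ smu.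
by exists (HB.pack_for {sigma_finite_measure set T -> \bar R}
  (measure_function.Measure.sort mu) sf sgf).
Qed.

Section fibrewise.
Context d1 d2 (T1 : measurableType d1) (T2 : measurableType d2) (R : realType).
Variable m1 : {sigma_finite_measure set T1 -> \bar R}.

(** [m1 \x^ m2] integrates over y the [m1]-measure of the horizontal section at
    height y, and the map acts on that section by [g y]. *)
Lemma preserves_prod_fst (m2 : {measure set T2 -> \bar R})
    (g : T2 -> T1 -> T1) :
  measurable_fun setT (fun p : T1 * T2 => g p.2 p.1) ->
  (forall y, preserves m1 (g y)) ->
  preserves (m1 \x^ m2)%E (fun p => (g p.2 p.1, p.2)).
Proof.
move=> mg Hg; split; first by apply: measurable_fun_pair.
move=> A mA; apply: eq_integral => y _ /=.
rewrite -((Hg y).2 (ysection A y)); last exact: measurable_ysection.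
by congr (m1 _); rewrite /ysection; apply/seteqP; split => x /=; rewrite !inE.
Qed.

(** Both orders of integration give the same product measure. *)
Lemma product_measure2_sym (m2 : {measure set T2 -> \bar R})
    (A : set (T1 * T2)) :
  sigma_finite setT m2 -> measurable A -> (m1 \x^ m2)%E A = (m1 \x m2)%E A.
Proof.
move=> /bundle_sigma_finite[M M2] mA; rewrite -M2; apply/esym.
apply: (@product_measure_unique _ _ T1 T2 R m1 M (m1 \x^ M)%E) => //.
by move=> X Y mX mY /=; rewrite product_measure2E.
Qed.

(** Symmetric to [preserves_prod_fst]: the order of integration is exchanged, so
    that the map acts on the vertical section at x by [g x]. *)
Lemma preserves_prod_snd (m2 : {measure set T2 -> \bar R})
    (g : T1 -> T2 -> T2) :
  sigma_finite setT m2 ->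
  measurable_fun setT (fun p : T1 * T2 => g p.1 p.2) ->
  (forall x, preserves m2 (g x)) ->
  preserves (m1 \x^ m2)%E (fun p => (p.1, g p.1 p.2)).
Proof.
move=> s2 mg Hg.
have mG : measurable_fun setT (fun p : T1 * T2 => (p.1, g p.1 p.2)).
  by apply: measurable_fun_pair.
split=> // A mA.
rewrite !product_measure2_sym //; last exact: measurable_preimage.
apply: eq_integral => x _ /=.
rewrite -((Hg x).2 (xsection A x)); last exact: measurable_xsection.
by congr (m2 _); rewrite /xsection; apply/seteqP; split => y /=; rewrite !inE.
Qed.

Lemma sigma_finite_product_measure2 (m2 : {measure set T2 -> \bar R}) :
  sigma_finite setT m2 -> sigma_finite setT (m1 \x^ m2)%E.
Proof.
move=> /sigma_finiteP[G [GT ndG Goo]].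
have /sigma_finiteP[F [FT ndF Foo]] := sigma_finiteT m1.
exists (fun n => F n `*` G n) => [|n]; last first.
  have [[mF F_oo] [mG G_oo]] := (Foo n, Goo n).
  split; first exact: measurableX.
  by rewrite product_measure2E // lte_mul_pinfty // ge0_fin_numE.
apply/esym; rewrite -subTset => -[x y] _.
have [n _ Fx] : (\bigcup_n F n) x by rewrite -FT.
have [l _ Gy] : (\bigcup_n G n) y by rewrite -GT.
exists (maxn n l) => //; split => /=.
  by move/subsetPset: (ndF _ _ (leq_maxl n l)); exact.
by move/subsetPset: (ndG _ _ (leq_maxr n l)); exact.
Qed.
End fibrewise.

(** Lebesgue measure is determined by its values on half-open intervals,
    whose length is kept by a translation. *)
Lemma preserves_translation (R : realType) (t : R) :
  preserves (@lebesgue_measure R)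
    (fun x : measurableTypeR R => x + t : measurableTypeR R).
Proof.
have mt : measurable_fun setT
    (fun x : measurableTypeR R => x + t : measurableTypeR R).
  by apply: measurable_funD.
split=> // A mA.
apply/esym.
apply: (@lebesgue_measure_unique R (pushforward lebesgue_measure _)) => //=.
move=> _ [[a b]] _ <-.
rewrite /pushforward.
rewrite (_ : _ @^-1` _ = `]a - t, b - t]%classic); last first.
  by apply/seteqP; split => x /=; rewrite !in_itv/= ltrBlDr lerBrDr.
rewrite /= !lebesgue_measure_itv/= !lte_fin ltrD2r.
by case: ifP => // _; rewrite -!EFinB opprB addrA subrK.
Qed.

(** C^k is the increasing union of the cubes [-n, n]^(2k). *)
Lemma sigma_finite_lebesgueC (R : realType) (k : nat) :
  sigma_finite setT (lebesgueC R k).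
Proof.
pose J (n : nat) := `[- n%:R, n%:R]%classic : set (measurableTypeR R).
have mJ n : measurable (J n) by exact: measurable_itv.
exists (fun n => [set x | forall i, J n (tnth x i).1 /\ J n (tnth x i).2]).
  apply/seteqP; split => // x _.
  pose M := \sum_(i < k) (`|(tnth x i).1| + `|(tnth x i).2|) : R.
  exists (Num.bound M) => //= i.
  have M0 : 0 <= M by apply: sumr_ge0 => j _; rewrite addr_ge0.
  have : `|(tnth x i).1| + `|(tnth x i).2| <= (Num.bound M)%:R.
    apply: le_trans (ltW (archi_boundP M0)).
    by rewrite /M (bigD1 i) //= lerDl; apply: sumr_ge0 => j _; rewrite addr_ge0.
  move=> H; rewrite /J /= !in_itv /= -!ler_norml; split;
    by apply: le_trans H; rewrite ?lerDl ?lerDr.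
move=> n; split.
  rewrite (_ : [set x | _] = \bigcap_(i in [set: 'I_k])
      ((@tnth _ _ ^~ i) @^-1` (J n `*` J n))).
    apply: fin_bigcap_measurable => // i _.
    apply: measurable_preimage; first exact: measurable_tnth.
    exact: measurableX.
  by apply/seteqP; split => x /= H i; [move=> _|]; have := H i => // /(_ I).
rewrite (@lebesgueC_box R k (fun=> J n) (fun=> J n)) //.
rewrite -ge0_fin_numE; last first.
  by apply: prode_ge0 => i _; rewrite mule_ge0.
apply: (big_ind (fun x => x \is a fin_num)) => // [x y|i _].
  exact: fin_numM.
by rewrite fin_numM // /J /= lebesgue_measure_itv /=; case: ifP.
Qed.

(** * Rotations preserve the Lebesgue measure of C^k *)

(** Multiplication by [c], in the real coordinates of C. *)
Definition rotate_pt (R : realType) (c : R[i])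
    (p : measurableTypeR R * measurableTypeR R) :
  measurableTypeR R * measurableTypeR R :=
  (complex.Re c * p.1 - complex.Im c * p.2,
   complex.Im c * p.1 + complex.Re c * p.2).

Definition rotate (R : realType) (k : nat) (c : R[i])
    (x : Cspace R k) : Cspace R k :=
  [tuple of map (rotate_pt c) x].

Lemma cvect_rotate (R : realType) (k : nat) (c : R[i]) (x : Cspace R k) :
  cvect (rotate c x) = c *: cvect x.
Proof.
apply/colP => j; rewrite !mxE tnth_map; case: c => a b /=.
by apply/eqP; rewrite eq_complex /= eqxx /= addrC eqxx.
Qed.

Lemma rotate_ccons (R : realType) (k : nat) (c : R[i]) p :
  rotate c (@ccons R k p) =
  ccons ((rotate_pt c (p.1, p.2.1)).1,
    ((rotate_pt c (p.1, p.2.1)).2, rotate c p.2.2)).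
Proof. by case: p => x [y t]; apply: val_inj. Qed.

Lemma preserves_shear (R : realType) d2 (T2 : measurableType d2)
    (mu : {measure set T2 -> \bar R}) (h : T2 -> R) :
  measurable_fun setT h ->
  preserves (@lebesgue_measure R \x^ mu)%E (fun p => (p.1 + h p.2, p.2)).
Proof.
move=> mh.
apply: (@preserves_prod_fst _ _ (measurableTypeR R) T2 R lebesgue_measure
  mu (fun y x => x + h y)).
  apply: measurable_funD; first exact: measurable_fst.
  exact: measurableT_comp measurable_snd.
by move=> y; exact: preserves_translation.
Qed.

Lemma rotateM (R : realType) (k : nat) (c c' : R[i]) :
  @rotate R k (c * c') = rotate c \o rotate c'.
Proof.
apply/funext => x; apply: eq_from_tnth => j /=; rewrite !tnth_map.
case: (tnth x j) => u v; case: c => a b; case: c' => a' b'.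
by rewrite /rotate_pt /=; congr pair; ring.
Qed.

Lemma normc1_Re2_Im2 (R : realType) (c : R[i]) :
  `|c| = 1 -> complex.Re c ^+ 2 + complex.Im c ^+ 2 = 1.
Proof. by move=> c1; apply: complexI; rewrite add_Re2_Im2 c1 expr1n. Qed.

(** The three shears are available when [Im c] is not zero: the slope of the
    horizontal ones is [(Re c - 1) / Im c], that is, minus the tangent of half
    the angle. The rotation of C^(k+1) is the composition of the three shears
    of the first coordinate with a rotation of the k others. *)
Lemma preserves_rotate_nonreal (R : realType) (k : nat) (c : R[i]) :
  `|c| = 1 -> complex.Im c != 0 -> preserves (lebesgueC R k) (rotate c).
Proof.
move=> c1 cI; have cN := normc1_Re2_Im2 c1.
elim: k => [|k IH].
  have rE : @rotate R 0 c = id.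
    by apply/funext => x; rewrite [x]tuple0 [LHS]tuple0.
  by rewrite rE; split => //; exact: measurable_id.
set mu := lebesgueC R k in IH *.
have smu : sigma_finite setT mu by exact: sigma_finite_lebesgueC.
pose L := @lebesgue_measure R.
pose T := measurableTypeR R.
pose t := (complex.Re c - 1) / complex.Im c.
(* These two relations say that the product of the three shear matrices is
   the rotation matrix; the second one uses [Re c ^ 2 + Im c ^ 2 = 1]. *)
have aE : complex.Re c = t * complex.Im c + 1 by rewrite divfK // subrK.
have tc : t * (t * complex.Im c + 2) = - complex.Im c.
  apply: (mulIf cI); move: cN; rewrite aE => cN.
  transitivity ((t * complex.Im c + 1) ^+ 2 - 1); first by ring.
  by rewrite -[X in _ - X]cN; ring.
have S1 : preserves (L \x^ (L \x^ mu))%E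
    (fun p : T * (T * Cspace R k) => (p.1 + t * p.2.1 : T, p.2)).
  apply: (@preserves_shear R _ _ (L \x^ mu)%E
    (fun q : T * Cspace R k => t * q.1)).
  by apply: measurable_funM => //; exact: measurable_fst.
have S2 : preserves (L \x^ (L \x^ mu))%E
    (fun p : T * (T * Cspace R k) =>
      (p.1, (p.2.1 + complex.Im c * p.1 : T, p.2.2))).
  apply: (@preserves_prod_snd _ _ T _ R L (L \x^ mu)%E
    (fun x q => (q.1 + complex.Im c * x, q.2))).
  - exact: sigma_finite_product_measure2.
  - apply: measurable_fun_pair; last exact: measurableT_comp measurable_snd.
    apply: measurable_funD; first exact: measurableT_comp measurable_snd.
    by apply: measurable_funM => //; exact: measurable_fst.
  - move=> x; exact: (@preserves_shear R _ _ mu (fun=> complex.Im c * x)).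
have S3 : preserves (L \x^ (L \x^ mu))%E
    (fun p : T * (T * Cspace R k) => (p.1, (p.2.1, rotate c p.2.2))).
  have S : preserves (L \x^ mu)%E
      (fun q : T * Cspace R k => (q.1, rotate c q.2)).
    apply: (@preserves_prod_snd _ _ T _ R L mu (fun=> rotate c)) => //.
    exact: measurableT_comp IH.1 measurable_snd.
  apply: (@preserves_prod_snd _ _ T _ R L (L \x^ mu)%E
    (fun _ q => (q.1, rotate c q.2))) => //.
    exact: sigma_finite_product_measure2.
  exact: measurableT_comp S.1 measurable_snd.
have := preserves_comp S3 (preserves_comp S1 (preserves_comp S2 S1)).
set G := (X in preserves _ X) => -[mG HG].
have GE : @rotate R k.+1 c \o @ccons R k = @ccons R k \o G.
  apply/funext => -[x [y v]]; rewrite /= rotate_ccons /G /rotate_pt /=.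
  congr (ccons (_, (_, _))).
    by rewrite -mulNr -tc aE; ring.
  by rewrite aE; ring.
split.
  apply/measurable_fun_tnthP => i.
  apply: (eq_measurable_fun (fun x => rotate_pt c (tnth x i))).
    by move=> x _; rewrite /= tnth_map.
  have mi : measurable_fun setT (fun x : Cspace R k.+1 => tnth x i).
    by exact: measurable_tnth.
  apply: measurable_fun_pair.
    apply: measurable_funB; apply: measurable_funM => //;
      apply: measurableT_comp mi => //.
  apply: measurable_funD; apply: measurable_funM => //;
    apply: measurableT_comp mi => //.
move=> A mA; rewrite /= /pushforward -comp_preimage GE comp_preimage.
by apply: HG; apply: measurable_preimage => //; exact: measurable_ccons.
Qed.

(** If [c] is 1 or -1, it is the product of the non-real numbers [c * i] and
    [- i]. *)
Lemma preserves_rotate (R : realType) (k : nat) (c : R[i]) :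
  `|c| = 1 -> preserves (lebesgueC R k) (rotate c).
Proof.
move=> c1.
have [cI|cI] := eqVneq (complex.Im c) 0; last first.
  exact: preserves_rotate_nonreal.
have cN := normc1_Re2_Im2 c1.
have -> : c = (c * 'i) * (- 'i).
  by rewrite -mulrA mulrN -expr2 sqr_i opprK mulr1.
rewrite rotateM; apply: preserves_comp; apply: preserves_rotate_nonreal.
- by rewrite normrM c1 mul1r normCi.
- rewrite ImiRe; apply: contra_eqN cN => /eqP ->.
  by rewrite cI expr0n /= addr0 eq_sym oner_eq0.
- by rewrite normrN normCi.
- by rewrite /= oppr_eq0 oner_eq0.
Qed.

(** * Moments of the complex Gaussian distribution *)

Lemma preserves_ge0_integral d (T : measurableType d) (R : realType)
    (mu : {measure set T -> \bar R}) (g : T -> T) (A : set T)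
    (f : T -> \bar R) :
  preserves mu g -> measurable A -> measurable_fun setT f ->
  (forall x, 0 <= f x)%E ->
  (\int[mu]_(x in g @^-1` A) f (g x) = \int[mu]_(x in A) f x)%E.
Proof.
move=> [mg Hg] mA mf f0.
rewrite -(ge0_integral_pushforward mg mu mA (f := f)) //.
  by apply: eq_measure_integral => B mB _; exact: Hg.
exact: measurable_funTS.
Qed.

(** The change of variables holds for the positive and the negative part of
    [f], and the integral of [f] is by definition the difference of their
    integrals, finite or not. *)
Lemma preserves_integral d (T : measurableType d) (R : realType)
    (mu : {measure set T -> \bar R}) (g : T -> T) (A : set T)
    (f : T -> \bar R) :
  preserves mu g -> measurable A -> measurable_fun setT f ->
  (\int[mu]_(x in g @^-1` A) f (g x) = \int[mu]_(x in A) f x)%E.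
Proof.
move=> gP mA mf; rewrite [LHS]integralE [RHS]integralE.
rewrite -(preserves_ge0_integral gP mA (f := f^\+%E)) //; last first.
  exact: measurable_funepos.
rewrite -(preserves_ge0_integral gP mA (f := f^\-%E)) //; last first.
  exact: measurable_funeneg.
by congr (_ - _)%E; apply: eq_integral => x _; rewrite ?funeposE ?funenegE.
Qed.

(** The positive and the negative part of [u] are exchanged by [g], hence have
    the same integral in [0, +oo]; if it is +oo, their difference is a
    conventional infinite value, sent to 0 by [fine]. *)
Lemma preserves_Rintegral_antisym d (T : measurableType d) (R : realType)
    (mu : {measure set T -> \bar R}) (g : T -> T) (u : T -> R) :
  preserves mu g -> measurable_fun setT u -> (forall x, u (g x) = - u x) ->
  \int[mu]_x u x = 0.
Proof.
move=> gP mu_ uN; rewrite /Rintegral integralE.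
pose f x := (u x)%:E.
have mf : measurable_fun setT f by exact/measurable_EFinP.
rewrite -(preserves_ge0_integral gP measurableT (f := f^\+%E)) //; last first.
  exact: measurable_funepos.
rewrite preimage_setT.
have -> : (fun x => f^\+%E (g x)) = f^\-%E.
  by apply/funext => x; rewrite funeposE funenegE /f uN.
by rewrite -/f; case: (integral _ _ _) => [r| |] //=; rewrite subrr.
Qed.

(** Borel measurability of a complex function, expressed by its two real
    components. *)
Definition cmeasurable d (T : measurableType d) (R : realType)
    (h : T -> R[i]) :=
  measurable_fun setT (fun x => complex.Re (h x)) /\
  measurable_fun setT (fun x => complex.Im (h x)).

Section cmeasurable.
Context d (T : measurableType d) (R : realType).
Implicit Types h : T -> R[i].

Lemma cmeasurable_cst (c : R[i]) : cmeasurable (fun _ : T => c).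
Proof. by split; exact: measurable_cst. Qed.

Lemma cmeasurableD h1 h2 : cmeasurable h1 -> cmeasurable h2 ->
  cmeasurable (fun x => h1 x + h2 x).
Proof.
move=> [r1 i1] [r2 i2]; split.
  apply: eq_measurable_fun (measurable_funD r1 r2) => x _ /=.
  by case: (h1 x) (h2 x) => ? ? [].
apply: eq_measurable_fun (measurable_funD i1 i2) => x _ /=.
by case: (h1 x) (h2 x) => ? ? [].
Qed.

Lemma cmeasurableM h1 h2 : cmeasurable h1 -> cmeasurable h2 ->
  cmeasurable (fun x => h1 x * h2 x).
Proof.
move=> [r1 i1] [r2 i2]; split.
  apply: eq_measurable_fun
    (measurable_funB (measurable_funM r1 r2) (measurable_funM i1 i2)) => x _ /=.
  by case: (h1 x) (h2 x) => ? ? [].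
apply: eq_measurable_fun
  (measurable_funD (measurable_funM r1 i2) (measurable_funM i1 r2)) => x _ /=.
by case: (h1 x) (h2 x) => ? ? [].
Qed.

Lemma cmeasurable_conj h : cmeasurable h -> cmeasurable (fun x => (h x)^*).
Proof.
move=> [r i]; split.
  by apply: eq_measurable_fun r => x _ /=; case: (h x).
by apply: eq_measurable_fun (measurable_funN i) => x _ /=; case: (h x).
Qed.

Lemma cmeasurable_sum I (s : seq I) (h : I -> T -> R[i]) :
  (forall i, cmeasurable (h i)) -> cmeasurable (fun x => \sum_(i <- s) h i x).
Proof.
move=> mh; elim: s => [|i s IH].
  by under eq_fun do rewrite big_nil; exact: cmeasurable_cst.
by under eq_fun do rewrite big_cons; exact: cmeasurableD.
Qed.

Lemma cmeasurable_prod I (s : seq I) (h : I -> T -> R[i]) :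
  (forall i, cmeasurable (h i)) -> cmeasurable (fun x => \prod_(i <- s) h i x).
Proof.
move=> mh; elim: s => [|i s IH].
  by under eq_fun do rewrite big_nil; exact: cmeasurable_cst.
by under eq_fun do rewrite big_cons; exact: cmeasurableM.
Qed.

Lemma cmeasurableX h n : cmeasurable h -> cmeasurable (fun x => h x ^+ n).
Proof.
move=> mh; elim: n => [|n IH].
  by under eq_fun do rewrite expr0; exact: cmeasurable_cst.
by under eq_fun do rewrite exprS; exact: cmeasurableM.
Qed.
End cmeasurable.

Lemma cmeasurable_cvect (R : realType) (k : nat) (j : 'I_k) :
  cmeasurable (fun x : Cspace R k => cvect x j ord0).
Proof.
have mj : measurable_fun setT (fun x : Cspace R k => tnth x j).
  exact: measurable_tnth.
split; under eq_fun do rewrite mxE /=; exact: measurableT_comp mj.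
Qed.

Lemma monom_atE (R : realType) (k : nat) (a : multinom k) (z : 'cV[R[i]]_k) :
  monom_at a z = \prod_(j < k) z j ord0 ^+ a j.
Proof. by rewrite /monom_at /peval mevalX. Qed.

Lemma monom_atZ (R : realType) (k : nat) (a : multinom k) (c : R[i])
    (z : 'cV[R[i]]_k) :
  monom_at a (c *: z) = c ^+ mdeg a * monom_at a z.
Proof.
rewrite !monom_atE mdegE -prodrXr -big_split /=; apply: eq_bigr => j _.
by rewrite mxE exprMn.
Qed.

Lemma cmeasurable_monom_at (R : realType) (k : nat) (a : multinom k) :
  cmeasurable (fun x : Cspace R k => monom_at a (cvect x)).
Proof.
under eq_fun do rewrite monom_atE.
by apply: cmeasurable_prod => j; apply/cmeasurableX/cmeasurable_cvect.
Qed.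

Lemma measurable_cgauss_density (R : realType) (k : nat) (Sigma : 'M[R[i]]_k) :
  measurable_fun setT (fun x : Cspace R k => cgauss_density Sigma (cvect x)).
Proof.
apply: measurable_funM => //; apply: measurableT_comp => //.
apply: measurable_funN.
apply: (proj1 (_ : cmeasurable _)).
under eq_fun do rewrite mxE.
apply: cmeasurable_sum => j; apply: cmeasurableM; last exact: cmeasurable_cvect.
under eq_fun do rewrite mxE.
apply: cmeasurable_sum => i; apply: cmeasurableM; last exact: cmeasurable_cst.
under eq_fun do rewrite mxE mxE.
exact/cmeasurable_conj/cmeasurable_cvect.
Qed.

Lemma cgauss_densityZ (R : realType) (k : nat) (Sigma : 'M[R[i]]_k) (c : R[i])
    (z : 'cV[R[i]]_k) :
  `|c| = 1 -> cgauss_density Sigma (c *: z) = cgauss_density Sigma z.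
Proof.
move=> c1; rewrite /cgauss_density.
suff -> : (c *: z)^t* *m invmx Sigma *m (c *: z) =
    z^t* *m invmx Sigma *m z by [].
rewrite [(c *: z)^T]linearZ /= map_mxZ -!scalemxAl -scalemxAr scalerA.
by rewrite mulrC -sqr_normc c1 expr1n scale1r.
Qed.

Lemma complex_gaussian_rotate (R : realType) (k : nat) (Sigma : 'M[R[i]]_k)
    (nu : probability (Cspace R k) R) (c : R[i]) :
  complex_gaussian Sigma nu -> `|c| = 1 -> preserves nu (rotate c).
Proof.
move=> nuG c1; have rP := preserves_rotate k c1.
split => [|A mA]; first exact: rP.1.
rewrite !nuG //; last exact: measurable_preimage rP.1 mA.
pose f (x : Cspace R k) := (cgauss_density Sigma (cvect x))%:E.
have mf : measurable_fun setT f.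
  by apply/measurable_EFinP; exact: measurable_cgauss_density.
rewrite -[RHS](preserves_integral (preserves_rotate k c1) mA mf).
by apply: eq_integral => x _; rewrite /f cvect_rotate cgauss_densityZ.
Qed.

Lemma moment0 (R : realType) (k : nat) (nu : probability (Cspace R k) R) :
  moment nu mnm0 = 1.
Proof.
have E : (fun x : Cspace R k => monom_at mnm0 (cvect x)) = fun=> 1 :> R[i].
  apply/funext => x; rewrite monom_atE big1 // => j _.
  by rewrite mnm0E expr0.
rewrite /moment E /cintegral !Rintegral_cst //.
by rewrite [X in fine X](probability_setT nu) /= mulr1 mul0r.
Qed.

(** The rotation by an N-th root of -1, where N is the degree of z^a, changes
    the sign of z^a. *)
Lemma complex_gaussian_moment_eq0 (R : realType) (k : nat) (Sigma : 'M[R[i]]_k)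
    (nu : probability (Cspace R k) R) (a : multinom k) :
  complex_gaussian Sigma nu -> a != mnm0 -> moment nu a = 0.
Proof.
move=> nuG a0; have N0 : (0 < mdeg a)%N by rewrite lt0n mdeg_eq0.
pose c : R[i] := (mdeg a).-root (-1).
have cN : c ^+ mdeg a = -1 by rewrite rootCK.
have c1 : `|c| = 1.
  by apply/eqP; rewrite -(pexpr_eq1 N0) // -normrX cN normrN1.
have rP := complex_gaussian_rotate nuG c1.
have uN x : monom_at a (cvect (rotate c x)) = - monom_at a (cvect x).
  by rewrite cvect_rotate monom_atZ cN mulN1r.
have [mR mI] := cmeasurable_monom_at R a.
rewrite /moment /cintegral !(preserves_Rintegral_antisym rP) //.
  by move=> x; rewrite uN; case: (monom_at _ _).
by move=> x; rewrite uN; case: (monom_at _ _).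
Qed.

(** * Indicator functions on the grid of roots of unity *)

Lemma complex_prim_root_exists (R : realType) (m : nat) :
  (0 < m)%N -> exists w : R[i], m.-primitive_root w.
Proof.
move=> m_gt0; pose p : {poly R[i]} := 'X^m - 1.
have [r Dp] := closed_field_poly_normal p.
rewrite (monicP _) ?monicXnsubC // scale1r in Dp.
have r1 : all m.-unity_root r by apply/allP => z; rewrite -root_prod_XsubC -Dp.
have szr : (m < (size r).+1)%N.
  by rewrite -(size_prod_XsubC r id) -Dp size_XnsubC.
have [|w _ wP] := hasP (has_prim_root m_gt0 r1 _ szr); last by exists w.
by rewrite -separable_prod_XsubC -Dp separable_Xn_sub_1 // pnatr_eq0 -lt0n.
Qed.

Lemma msupp_mspan (R : realType) (k : nat) (f : mpoly k R[i])
    (M : set (multinom k)) (a : multinom k) :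
  mspan M f -> a \in msupp f -> M a.
Proof.
move=> [s [c [sM ->]]]; rewrite mcoeff_msupp raddf_sum /=.
apply: contraNP => Ma; apply/eqP; rewrite big1_seq // => b /andP[_ bs].
rewrite mcoeffZ mcoeffX; case: eqP => [ba|]; last by rewrite mulr0.
by case: Ma; rewrite -ba; exact: sM.
Qed.

Section grid.
Context (R : realType) (k m : nat) (w : R[i]).
Hypothesis wP : m.-primitive_root w.

Let m_gt0 : (0 < m)%N. Proof. exact: prim_order_gt0 wP. Qed.

Lemma prim_root_mulJ : w * w^* = 1.
Proof.
rewrite -sqr_normc; have /eqP -> : `|w| == 1; last by rewrite expr1n.
by rewrite -(pexpr_eq1 m_gt0) // -normrX (prim_expr_order wP) normr1.
Qed.

(** The sum is geometric, of ratio [x = w^(a-b)], which is an m-th root of unity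
    and is 1 exactly when [a = b]. *)
Lemma prim_root_orthogonality (a b : nat) : (a < m)%N -> (b < m)%N ->
  \sum_(s < m) (w ^+ s) ^+ a * ((w ^+ s) ^+ b)^* = ((a == b) * m)%:R.
Proof.
move=> am bm; pose x := w ^+ a * (w^*) ^+ b.
under eq_bigr => s _.
  rewrite !rmorphXn /= -!exprM mulnC (mulnC s).
  rewrite !exprM -exprMn -/x.
  over.
have xb : x * w ^+ b = w ^+ a.
  by rewrite /x -mulrA -exprMn (mulrC w^*) prim_root_mulJ expr1n mulr1.
have x1 : (x == 1) = (a == b).
  rewrite -(modn_small am) -(modn_small bm) -(eq_prim_root_expr wP) -xb.
  rewrite -subr_eq0 -[RHS]subr_eq0 -[X in _ = (_ - X == 0)]mul1r -mulrBl.
  rewrite mulf_eq0.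
  by rewrite expf_eq0 (prim_root_eq0 wP) (gtn_eqF m_gt0) andbF orbF.
have [/eqP ab|ab] := boolP (a == b).
  move: x1; rewrite ab eqxx => /eqP ->.
  by under eq_bigr do rewrite expr1n; rewrite sumr_const card_ord mul1n.
have xm : x ^+ m = 1.
  have wm := prim_expr_order wP.
  have wJm : (w^*) ^+ m = 1 by rewrite -rmorphXn /= wm rmorph1.
  by rewrite /x exprMn -!exprM !(mulnC _ m) !exprM wm wJm !expr1n mulr1.
apply/eqP; have := subrX1 x m; rewrite xm subrr => /esym/eqP.
by rewrite mulf_eq0 subr_eq0 x1 (negbTE ab).
Qed.

(** Points of the grid are indexed by their vectors of discrete logarithms to
    the base [w], which turns a sum over the grid into a product of sums. *)
Definition grid_point (t : {ffun 'I_k -> 'I_m}) : 'cV[R[i]]_k :=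
  \col_j w ^+ t j.

Lemma grid_point_inj : injective grid_point.
Proof.
move=> t u /colP tu; apply/ffunP => j; apply: val_inj => /=.
have /eqP := tu j; rewrite !mxE (eq_prim_root_expr wP) !modn_small //.
exact: eqP.
Qed.

Lemma grid_pointP z : root_grid m z <-> exists t, z = grid_point t.
Proof.
split=> [zm|[t ->] j]; last first.
  by rewrite mxE -exprM mulnC exprM (prim_expr_order wP) expr1n.
have H j : exists s : 'I_m, z j ord0 = w ^+ s.
  by have [s ->] := prim_rootP wP (zm j); exists s.
have [t tP] := choice H.
by exists [ffun j => t j]; apply/colP => j; rewrite mxE ffunE.
Qed.

Lemma monom_orthogonality (a b : multinom k) :
  monomials_lt m a -> monomials_lt m b ->
  \sum_t monom_at a (grid_point t) * (monom_at b (grid_point t))^* =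
  ((a == b) * m ^ k)%:R.
Proof.
move=> am bm.
under eq_bigr => t _.
  rewrite !monom_atE rmorph_prod -big_split /=.
  under eq_bigr do rewrite !mxE.
  over.
rewrite -(bigA_distr_bigA
  (fun j (s : 'I_m) => (w ^+ s) ^+ a j * ((w ^+ s) ^+ b j)^*)).
under eq_bigr do rewrite prim_root_orthogonality //.
rewrite -natr_prod; congr _%:R.
have [->|ab] := eqVneq a b.
  by under eq_bigr do rewrite eqxx mul1n; rewrite prod_nat_const card_ord mul1n.
have [j abj] : exists j, a j != b j.
  apply/existsP; apply: contraNT ab => /existsPn H; apply/eqP/mnmP => j.
  by apply/eqP; rewrite -[_ == _]negbK H.
by rewrite (bigD1 j) //= (negbTE abj).
Qed.

(** The nodes are distinct grid points, and distinct exponent vectors give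
    distinct grid points. *)
Lemma sum_nodes_grid (D : seq 'cV[R[i]]_k) (F : 'cV[R[i]]_k -> R[i]) :
  uniq D -> (forall d, d \in D -> root_grid m d) ->
  \sum_(d <- D) F d = \sum_t (grid_point t \in D)%:R * F (grid_point t).
Proof.
move=> uD Dm.
rewrite (perm_big
  [seq grid_point t | t <- enum {ffun 'I_k -> 'I_m} & grid_point t \in D]).
  rewrite /= big_map big_filter big_enum_cond /= big_mkcond /=.
  by apply: eq_bigr => t _; case: (_ \in _); rewrite ?mul1r ?mul0r.
apply: uniq_perm => //.
  by rewrite (map_inj_uniq grid_point_inj) filter_uniq // enum_uniq.
move=> d; apply/idP/mapP => [dD|[t]]; last first.
  by rewrite mem_filter => /andP[? _] ->.
have [t dt] := (grid_pointP d).1 (Dm d dD).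
by exists t; rewrite // mem_filter mem_enum -dt dD.
Qed.

(** Fourier inversion on the grid: [f] is paired with the monomial z^b, using
    its values on one side and its expansion on the other. *)
Lemma indicator_coefficient (D : seq 'cV[R[i]]_k) (f : mpoly k R[i]) b :
  uniq D -> (forall d, d \in D -> root_grid m d) ->
  interpolates_indicator m D f -> monomials_lt m b ->
  mcoeff b f * (m ^ k)%:R = (\sum_(d <- D) monom_at b d)^*.
Proof.
move=> uD Dm [fspan fD] bm.
rewrite rmorph_sum /= (sum_nodes_grid (fun d => (monom_at b d)^*) uD Dm).
under eq_bigr => t _.
  rewrite -fD; last by apply/grid_pointP; exists t.
  rewrite /peval mevalE big_distrl /=.
  under eq_bigr do rewrite -monom_atE -mulrA.
  over.
rewrite exchange_big /=; under eq_big_seq => a af.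
  rewrite -big_distrr /= monom_orthogonality //; last first.
    exact: msupp_mspan fspan af.
  over.
have [bf|bf] := boolP (b \in msupp f).
  rewrite (bigD1_seq b) //= eqxx mul1n big1 ?addr0 // => a /negbTE ->.
  by rewrite mulr0.
rewrite (memN_msupp_eq0 bf) mul0r big1_seq // => a /andP[_ af].
by case: eqP af bf => [->|_] => [->|_ _] //; rewrite mulr0.
Qed.

End grid.

Lemma monom_at_mresidue (R : realType) (k m : nat) (a : multinom k)
    (z : 'cV[R[i]]_k) :
  root_grid m z -> monom_at (mresidue m a) z = monom_at a z.
Proof.
move=> zm; rewrite !monom_atE; apply: eq_bigr => j _.
rewrite mnmE [in RHS](divn_eq (a j) m) exprD mulnC exprM zm expr1n.
by rewrite mul1r.
Qed.

Lemma msupp_indicator (R : realType) (k m : nat) (D : seq 'cV[R[i]]_k)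
    (f : mpoly k R[i]) (a : multinom k) :
  (0 < m)%N -> uniq D -> (forall d, d \in D -> root_grid m d) ->
  interpolates_indicator m D f ->
  (mresidue m a \in msupp f) = (\sum_(d <- D) monom_at a d != 0).
Proof.
move=> m0 uD Dm fD; have [w wP] := complex_prim_root_exists R m0.
have <- : \sum_(d <- D) monom_at (mresidue m a) d = \sum_(d <- D) monom_at a d.
  by apply: eq_big_seq => d dD; rewrite (monom_at_mresidue _ (Dm d dD)).
have am : monomials_lt m (mresidue m a).
  by move=> j; rewrite mnmE ltn_pmod.
rewrite mcoeff_msupp; congr negb.
rewrite -[RHS](fmorph_eq0 Num.conj).
rewrite -[X in _ = (X == 0)](indicator_coefficient wP uD Dm fD am).
by rewrite mulf_eq0 pnatr_eq0 expn_eq0 (gtn_eqF m0) /= orbF.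
Qed.

Theorem corollary2 (R : realType) (k m n q : nat)
    (Sigma : 'M[R[i]]_k) (nu : probability (Cspace R k) R)
    (D : n.-tuple 'cV[R[i]]_k) (f : mpoly k R[i])
    (S : q.-tuple (multinom k)) :
  (0 < m)%N -> (0 < n)%N ->
  hermitian_posdef Sigma -> complex_gaussian Sigma nu ->
  uniq D -> (forall d, d \in D -> root_grid m d) ->
  interpolates_indicator m D f ->
  uniq S -> (forall a, a \in S -> monomials_lt m a) ->
  correct_pair D (mspan [set a | a \in S]) ->
  weights nu D S = const_mx (n%:R^-1) ->
  precision_basis nu D (weights nu D S)
    ([set mnm0] `|` [set a | mresidue m a \notin msupp f]).
Proof.
move=> m0 n0 _ nuG uD Dm fD _ _ _ ->.
have n_neq0 : n%:R != 0 :> R[i] by rewrite pnatr_eq0 -lt0n.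
have wE a : \sum_(i < n) (const_mx n%:R^-1 : 'cV[R[i]]_n) i ord0 *
    monom_at a (tnth D i) = n%:R^-1 * \sum_(d <- D) monom_at a d.
  by rewrite big_tuple mulr_sumr; apply: eq_bigr => i _; rewrite mxE.
have suppE a := msupp_indicator a m0 uD Dm fD.
split=> [a Ba|a /not_orP[/eqP a0 /negP]]; rewrite wE.
  have [->|a0] := eqVneq a mnm0.
    rewrite moment0 (eq_bigr (fun=> 1)) => [|d _]; last first.
      by rewrite monom_atE big1 // => j _; rewrite mnm0E expr0.
    by rewrite big_tuple sumr_const card_ord mulVf.
  rewrite (complex_gaussian_moment_eq0 nuG a0).
  case: Ba => [/eqP|/=]; first by rewrite (negbTE a0).
  by rewrite suppE negbK => /eqP ->; rewrite mulr0.
rewrite negbK suppE (complex_gaussian_moment_eq0 nuG a0) => s0 /esym/eqP.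
by rewrite mulf_eq0 invr_eq0 (negbTE n_neq0) (negbTE s0).
Qed.
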